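(* For the distributionally robust chance constrained program with $\infty$-Wasserstein ambiguity set, $$v_\infty^*=\min_{x\in\mathcal X}\Big\{c^\top x:\ \inf_{\mathbb P\in\mathcal P_\infty^W}\mathbb P\{g_i(x,\tilde\xi)\le0,\ \forall i\in[I]\}\ge1-\varepsilon\Big\},$$ the worst-case ALSO-X outperforms (is at least as good as) the worst-case CVaR approximation, i.e. $v_\infty^A\le v_\infty^{\mathrm{CVaR}}$.
   Context: Setting. $\Xi\subseteq\mathbb R^m$, $\varepsilon\in(0,1)$, $c\in\mathbb R^n$, $\theta\ge0$. Assumptions: each $g_i:\mathbb R^n\times\Xi\to\mathbb R$ ($i\in[I]$) is convex and lower semicontinuous in $x$; $\mathcal X\subseteq\mathbb R^n$ is nonempty, closed, convex and contained in a closed pointed convex cone $\mathcal C$; the program is feasible and $c\in\mathrm{int}(\mathcal C^* )\cup\{0\}$. The reference distribution $\mathbb P_{\tilde\zeta}$ (law of $\tilde\zeta$ on $\Xi$) is sub-Gaussian: $\mathbb P_{\tilde\zeta}\{\|\tilde\zeta\|\ge r\}\le C_1\exp(-C_2r^2)$ for some constants $C_1,C_2>0$. It is taken for granted that $\bar g_i(x,\zeta):=\max_{\xi\in\Xi}\{g_i(x,\xi):\|\xi-\zeta\|\le\theta\}$ is a well-defined real-valued function. Ambiguity set: $\mathcal P_\infty^W=\{\mathbb P:\ \mathbb P\{\tilde\xi\in\Xi\}=1,\ W_\infty(\mathbb P,\mathbb P_{\tilde\zeta})\le\theta\}$, where $W_\infty(\mathbb P_1,\mathbb P_2)$ is the infimum,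 over joint distributions $\mathbb Q$ with marginals $\mathbb P_1,\mathbb P_2$, of the $\mathbb Q$-essential supremum of $\|\xi_1-\xi_2\|$. Worst-case ALSO-X: $$v_\infty^A=\min_t\ t\ \text{ s.t. }\ x^*\in\operatorname*{argmin}_{x\in\mathcal X,\,c^\top x\le t}\ \sup_{\mathbb P\in\mathcal P_\infty^W}\mathbb E_{\mathbb P}\Big[\max_{i\in[I]}g_i(x,\tilde\xi)_+\Big],\qquad\inf_{\mathbb P\in\mathcal P_\infty^W}\mathbb P\{g_i(x^*,\tilde\xi)\le0,\forall i\in[I]\}\ge1-\varepsilon.$$ Convention: $\min$ over $t$ is an infimum; $t$ is feasible if $\{x\in\mathcal X:c^\top x\le t\}\ne\emptyset$ and every lower-level optimal solution $x^*$ satisfies the robust chance constraint; the lower-level optimum is taken to be finite and attained whenever the lower-level feasible set is nonempty. Worst-case CVaR approximation: $$v_\infty^{\mathrm{CVaR}}=\min_{x\in\mathcal X}\Big\{c^\top x:\ \sup_{\mathbb P\in\mathcal P_\infty^W}\inf_\beta\Big[\beta+\tfrac1\varepsilon\mathbb E_{\mathbb P}\big[\max_{i\in[I]}(g_i(x,\tilde\xi)-\beta)_+\big]\Big]\le0\Big\}.$$ *)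

(* Defs.v *)
From HB Require Import structures.
From mathcomp Require Import all_boot all_order all_algebra.
From mathcomp Require Import all_classical all_reals all_analysis.
From mathcomp Require Import ess_sup_inf.

Set Implicit Arguments.
Unset Strict Implicit.
Unset Printing Implicit Defensive.

Import Order.TTheory GRing.Theory Num.Theory.
Import numFieldNormedType.Exports.

Local Open Scope classical_set_scope.
Local Open Scope ring_scope.

(* R^m with its Borel sigma-algebra; the carrier is convertible to 'rV[R]_m. *)
Definition borel_rV (R : realType) (m : nat) :=
  g_sigma_algebraType (@open 'rV[R]_m).

(* The norm on R^m is arbitrary, not necessarily the library's sup norm. *)
Definition is_norm (R : realType) (m : nat) (N : 'rV[R]_m -> R) : Prop :=
  [/\ forall x y, N (x + y) <= N x + N y,
      forall a x, N (a *: x) = `|a| * N x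
    & forall x, N x = 0 -> x = 0].

Definition dotp (R : realType) (n : nat) (c x : 'rV[R]_n) : R :=
  \sum_(j < n) c ord0 j * x ord0 j.

Definition closed_pointed_convex_cone (R : realType) (n : nat)
    (C : set 'rV[R]_n) : Prop :=
  [/\ closed C,
      forall x, C x -> C (- x) -> x = 0,
      convex_set (C : set (convex_lmodType 'rV[R]_n))
    & forall a x, 0 <= a -> C x -> C (a *: x)].

Definition dual_cone (R : realType) (n : nat) (C : set 'rV[R]_n) :
    set 'rV[R]_n :=
  [set y | forall x, C x -> 0 <= dotp y x].

Section wasserstein_infty.
Context (R : realType) (m : nat) (N : 'rV[R]_m -> R).
Let T := borel_rV R m.

Definition coupling (P1 P2 : probability T R) (Q : probability (T * T)%type R)
    : Prop :=
  forall A : set T, measurable A ->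
    pushforward Q fst A = P1 A /\ pushforward Q snd A = P2 A.

Definition Winfty (P1 P2 : probability T R) : \bar R :=
  ereal_inf [set ess_sup Q
      (fun z : T * T => (N ((z.1 : 'rV[R]_m) - (z.2 : 'rV[R]_m)))%:E)
    | Q in coupling P1 P2].

Definition Winfty_ball (Xi : set T) (mu : probability T R) (theta : R) :
    set (probability T R) :=
  [set P : probability T R | P Xi = 1%E /\ (Winfty P mu <= theta%:E)%E].

Definition sub_gaussian (mu : probability T R) : Prop :=
  exists C1 C2 : R, [/\ 0 < C1, 0 < C2 &
    forall r : R, 0 <= r ->
      (mu [set z : T | (r <= N z)%R] <= (C1 * expR (- (C2 * r ^+ 2)))%:E)%E].

End wasserstein_infty.

(* For k = 0 the value is 0. *)
Definition max_pos (R : realType) (k : nat) (f : 'I_k -> R) : R :=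
  \big[Num.max/0]_(i < k) Num.max (f i) 0.

Section drccp.
Context (R : realType) (n m k : nat).
Let T := borel_rV R m.
Context (g : 'I_k -> 'rV[R]_n -> 'rV[R]_m -> R)
  (Xi : set T) (PP : set (probability T R)) (eps : R)
  (X : set 'rV[R]_n) (c : 'rV[R]_n).

(* The values of g outside Xi are irrelevant: all integrals and events below
   are restricted to Xi. *)

Definition robust_chance (x : 'rV[R]_n) : Prop :=
  ((1 - eps)%:E <=
   ereal_inf [set P [set xi : T | Xi xi /\ forall i, (g i x xi <= 0)%R]
             | P in PP])%E.

Definition drccp_feasible : set 'rV[R]_n := [set x | X x /\ robust_chance x].

Definition worst_loss (x : 'rV[R]_n) : \bar R :=
  ereal_sup [set (\int[P]_(xi in Xi) (max_pos (fun i => g i x xi))%:E)%E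
            | P in PP].

Definition lower_feasible (t : R) : set 'rV[R]_n :=
  [set x | X x /\ dotp c x <= t].

Definition lower_argmin (t : R) : set 'rV[R]_n :=
  [set x | lower_feasible t x /\
    forall y, lower_feasible t y -> (worst_loss x <= worst_loss y)%E].

Definition alsox_feasible : set R :=
  [set t | lower_feasible t !=set0 /\
    forall x, lower_argmin t x -> robust_chance x].

Definition alsox_value : \bar R := ereal_inf [set t%:E | t in alsox_feasible].

Definition cvar (P : probability T R) (x : 'rV[R]_n) : \bar R :=
  ereal_inf [set (b%:E + (eps^-1)%:E *
      \int[P]_(xi in Xi) (max_pos (fun i => (g i x xi - b)%R))%:E)%E
    | b in [set: R]].

Definition cvar_feasible : set 'rV[R]_n :=
  [set x | X x /\ (ereal_sup [set cvar P x | P in PP] <= 0)%E].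

Definition cvar_value : \bar R :=
  ereal_inf [set (dotp c x)%:E | x in cvar_feasible].

End drccp.

(* Main.v *)
Require Import Defs.
From HB Require Import structures.
From mathcomp Require Import all_boot all_order all_algebra.
From mathcomp Require Import ring lra measurable_realfun ess_sup_inf.
From mathcomp Require Import all_classical all_reals all_analysis.

(* Let x0 be feasible for the CVaR approximation, x1 a lower-level minimizer for
   t = c x0, W > 0 its worst-case loss, and suppose that some P0 in the ball
   gives the violation event of x1 a probability > eps.  Put
   x_lam = (1 - lam) x1 + lam x0.  For small lam the event
   F = {max_i ((1 - lam) g_i(x1) + lam g_i(x0)) > 0} still has P0-probability
   >= eps.  By optimality of x1, some P1 in the ball gives x_lam an expected
   loss > (1 - lam) W.  The ball contains a P that is at least as good as P0 on F
   and as P1 on all subsets of F; since P F >= eps, the CVaR constraint for P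
   bounds the expected loss of x_lam under P by (1 - lam) W, a contradiction.

   P moves mass point by point, so it needs couplings with distance <= theta,
   while W_infty only yields couplings with distance <= theta + 1/j.  We take an
   ultrafilter limit of these on rectangles.  The limit is only a bimeasure, but
   densities on the second marginal make sense for bimeasures, and a bimeasure is
   turned back into couplings with distance <= theta + e by taking products on
   small cells.  No measurable selection is needed. *)

Set Implicit Arguments.
Unset Strict Implicit.
Unset Printing Implicit Defensive.

Import Order.TTheory GRing.Theory Num.Theory.
Import numFieldNormedType.Exports.

Local Open Scope classical_set_scope.
Local Open Scope ring_scope.

(** * Measures *)

Section measures_from_functions.
Context d (T : measurableType d) (R : realType).
Implicit Types (A B : set T).

Lemma measure_eq0S (nu : {measure set T -> \bar R}) A B :
  measurable A -> measurable B -> A `<=` B -> nu B = 0%E -> nu A = 0%E.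
Proof. by move=> mA mB AB nuB; exact: subset_measure0 AB nuB. Qed.

Section measure_of_function.
Variables (f : set T -> \bar R) (f0 : f set0 = 0%E).
Variables (f_ge0 : forall A, (0 <= f A)%E) (f_sigma : semi_sigma_additive f).

(** The proofs are arguments of [measure_of] so that a measure structure can be attached to the term
    itself; [probability_of] and [finite_measure_of] follow the same pattern. *)
Definition measure_of (_ : f set0 = 0%E) (_ : forall A, (0 <= f A)%E)
  (_ : semi_sigma_additive f) := f.
Local Notation nu := (measure_of f0 f_ge0 f_sigma).
HB.instance Definition _ := isMeasure.Build _ _ _ nu f0 f_ge0 f_sigma.

Lemma exists_measure :
  exists nu : {measure set T -> \bar R}, forall A, nu A = f A.
Proof. by exists nu. Qed.

End measure_of_function.

Section probability_of_measure.
Variables (f : {measure set T -> \bar R}) (f1 : f setT = 1%E).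

Definition probability_of (_ : f setT = 1%E) : set T -> \bar R := f.
Local Notation nu := (probability_of f1).
HB.instance Definition _ := Measure.on nu.
HB.instance Definition _ := @Measure_isProbability.Build _ _ _ nu f1.

Lemma exists_probability : exists P : probability T R, forall A, P A = f A.
Proof. by exists nu. Qed.

End probability_of_measure.

Lemma additive_bigsetU (f : set T -> R) (s : (set T)^nat) n :
    (forall A B, measurable A -> measurable B -> A `&` B = set0 ->
       f (A `|` B) = f A + f B) ->
    (forall i, measurable (s i)) -> trivIset setT s ->
  f (\big[setU/set0]_(i < n) s i) = \sum_(i < n) f (s i).
Proof.
move=> fD ms ts; elim: n => [|n IH].
  have := fD _ _ measurable0 measurable0 (set0I _).
  by rewrite !big_ord0 setU0; lra.
rewrite !big_ord_recr/= fD ?IH//; first exact: bigsetU_measurable.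
rewrite -bigcup_mkord -subset0 => x /= [[i /= ni six] snx].
have E : i = n by apply: ts => //; exists x.
by rewrite E ltnn in ni.
Qed.

(** The [mu]-mass of the tails of a disjoint union tends to 0, and domination passes this on to [f];
    this upgrades finite additivity to sigma-additivity. *)
Lemma dominated_additive_measure (mu : probability T R) (f : set T -> R) :
    (forall A, measurable A -> 0 <= f A) ->
    (forall A, measurable A -> ((f A)%:E <= mu A)%E) ->
    (forall A B, measurable A -> measurable B -> A `&` B = set0 ->
       f (A `|` B) = f A + f B) ->
  exists nu : {measure set T -> \bar R},
    forall A, measurable A -> nu A = (f A)%:E.
Proof.
move=> f_ge0 f_le fD.
have f0 : f set0 = 0.
  by have := fD _ _ measurable0 measurable0 (set0I _); rewrite setU0; lra.
pose F A := if pselect (measurable A) then (f A)%:E else 0%E.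
have FE A : measurable A -> F A = (f A)%:E by rewrite /F; case: pselect.
have F_ge0 A : (0 <= F A)%E.
  by rewrite /F; case: pselect => // mA; rewrite lee_fin f_ge0.
have fmono A B : measurable A -> measurable B -> A `<=` B -> f A <= f B.
  move=> mA mB AB; rewrite -(setDUK AB) fD ?lerDl ?f_ge0//.
  - exact: measurableD.
  - exact: measurableD.
  - by rewrite setDIK.
have muE A : measurable A -> mu A = (fine (mu A))%:E.
  by move=> mA; rewrite fineK// fin_num_measure.
have Fsa : semi_sigma_additive F.
  move=> s ms ts mU.
  rewrite FE//.
  have -> : (fun n => \sum_(0 <= i < n) F (s i))%E =
            (fun n => (\sum_(i < n) f (s i))%:E).
    by apply/funext => n; rewrite big_mkord -sumEFin; apply: eq_bigr => i _; rewrite FE.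
  apply/fine_cvgP; split; first exact: nearW.
  have cmu : (fun n => \sum_(i < n) fine (mu (s i))) @ \oo --> fine (mu (\bigcup_n s n)).
    have H : (\sum_(0 <= i < n) mu (s i))%E @[n --> \oo] -->
        (fine (mu (\bigcup_n s n)))%:E.
      by rewrite -muE//; exact: measure_semi_sigma_additive.
    apply: cvg_trans (fine_cvg H).
    apply: near_eq_cvg; apply: nearW => n /=.
    by rewrite big_mkord sum_fine// => i _; exact: fin_num_measure.
  (* [lo n] is [f] of the union minus the [mu]-mass of the tail, which bounds the [f]-mass of the
     tail. *)
  pose lo n := \sum_(i < n) fine (mu (s i)) - fine (mu (\bigcup_n s n)) +
    f (\bigcup_n s n).
  apply: (@squeeze_cvgr _ _ _ _ lo (fun=> f (\bigcup_n s n))).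
  - apply: nearW => n /=.
    set S := \big[setU/set0]_(i < n) s i.
    have mS : measurable S by exact: bigsetU_measurable.
    have SU : S `<=` \bigcup_n s n.
      by rewrite /S -bigcup_mkord; apply: bigcup_sub => i _; exact: bigcup_sup.
    rewrite -(@additive_bigsetU f)// fmono// andbT /lo.
    have : f (\bigcup_n s n `\` S) <= fine (mu (\bigcup_n s n `\` S)).
      by rewrite -lee_fin -muE ?f_le//; exact: measurableD.
    have : f (\bigcup_n s n) = f S + f (\bigcup_n s n `\` S).
      by rewrite -{1}(setDUK SU) fD// ?setDIK//; exact: measurableD.
    have : mu (\bigcup_n s n) = (mu S + mu (\bigcup_n s n `\` S))%E.
      by rewrite -{1}(setDUK SU) measureU// ?setDIK//; exact: measurableD.
    have -> : mu S = (\sum_(i < n) fine (mu (s i)))%:E.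
      rewrite muE//; congr EFin; apply: (@additive_bigsetU (fine \o mu)) => //=.
      by move=> A B mA mB AB; rewrite measureU// fineD// fin_num_measure.
    rewrite (muE (_ `\` _)); last exact: measurableD.
    rewrite (muE _ mU).
    by rewrite -EFinD => -[]; lra.
  - rewrite -[X in _ --> X]add0r -(subrr (fine (mu (\bigcup_n s n)))).
    exact: cvgD (cvgB cmu (cvg_cst _)) (cvg_cst _).
  - exact: cvg_cst.
have [|nu nuE] := exists_measure _ F_ge0 Fsa; first by rewrite FE// f0.
by exists nu => A mA; rewrite nuE FE.
Qed.

Section finite_measure_of_measure.
Variables (f : {measure set T -> \bar R}) (foo : (f setT < +oo)%E).

Definition finite_measure_of (_ : (f setT < +oo)%E) : set T -> \bar R := f.
Local Notation nu := (finite_measure_of foo).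
HB.instance Definition _ := Measure.on nu.
Let nu_fin : fin_num_fun nu. Proof. exact: lty_fin_num_fun. Qed.
HB.instance Definition _ := @Measure_isFinite.Build _ _ _ nu nu_fin.

Lemma exists_finite_measure :
  exists nu : {finite_measure set T -> \bar R}, forall A, nu A = f A.
Proof. by exists nu. Qed.

End finite_measure_of_measure.

Lemma exists_density (nu mu : {measure set T -> \bar R}) :
    (nu setT < +oo)%E -> (mu setT < +oo)%E ->
    (forall A, measurable A -> mu A = 0%E -> nu A = 0%E) ->
  exists f : T -> \bar R, [/\ forall x, (0 <= f x)%E,
    measurable_fun setT f &
    forall A, measurable A -> nu A = (\int[mu]_(x in A) f x)%E].
Proof.
move=> /exists_finite_measure[nu' nuE] /exists_finite_measure[mu' muE] numu.
have [|f [f0 intf fE]] := @radon_nikodym_finite _ _ _ mu' nu'.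
  apply/null_content_dominatesP => A mA mu'A0; rewrite nuE.
  by apply: numu => //; rewrite -muE.
exists f; split => //; first exact: measurable_int intf.
move=> A mA; rewrite -nuE; apply: etrans (fE _ mA) _.
by apply: eq_measure_integral => B mB _; exact: muE.
Qed.

Lemma exists_measure_density (nu : {measure set T -> \bar R}) (f : T -> \bar R) :
    (forall x, 0 <= f x)%E -> measurable_fun setT f ->
  exists nu' : {measure set T -> \bar R},
    forall A, nu' A = (\int[nu]_(x in A) f x)%E.
Proof.
move=> f0 mf; apply: exists_measure.
- exact: integral_set0.
- by move=> A; exact: integral_ge0.
- exact: semi_sigma_additive_nng_induced.
Qed.

(** The integral of a nonnegative function against a series of measures is the series of the
    integrals. This turns a density on one coordinate of a bimeasure into a measure in the other
    coordinate. *)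
Lemma exists_measure_integral (kappa : set T -> {measure set T -> \bar R})
    (f : T -> \bar R) B : measurable B ->
    (forall x, 0 <= f x)%E -> measurable_fun setT f ->
    (forall B, measurable B -> kappa set0 B = 0%E) ->
    (forall B, measurable B -> semi_sigma_additive (kappa^~ B)) ->
  exists nu : {measure set T -> \bar R},
    forall A, nu A = (\int[kappa A]_(x in B) f x)%E.
Proof.
move=> mB f0 mf k0 ksa.
apply: (@exists_measure (fun A => \int[kappa A]_(x in B) f x)%E).
- rewrite (eq_measure_integral mzero) ?integral_measure_zero// => A mA _.
  exact: k0.
- by move=> A; exact: integral_ge0.
- move=> s ms ts mU.
  rewrite (eq_measure_integral (mseries (kappa \o s) 0)); last first.
    by move=> A mA _; apply/esym/cvg_lim => //; exact: ksa.
  rewrite ge0_integral_measure_series//; last exact: measurable_funTS.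
  by apply: is_cvg_ereal_nneg_natsum => n _; exact: integral_ge0.
Qed.

Lemma integral_eq0_pos (mu : {measure set T -> \bar R}) (f : T -> \bar R) A :
    measurable A -> measurable_fun A f -> (forall x, A x -> 0 < f x)%E ->
    (\int[mu]_(x in A) f x)%E = 0%E ->
  mu A = 0%E.
Proof.
move=> mA mf f_gt0 intf0.
have : ae_eq mu A f (cst 0%E).
  apply/ae_eq_integral_abs => //.
  apply: etrans intf0; apply: eq_integral => x; rewrite inE => Ax.
  by rewrite gee0_abs// ltW// f_gt0.
move=> [M [mM M0 AM]]; apply: (measure_eq0S mA mM) M0 => x Ax.
by apply: AM => /= /(_ Ax) fx0; have := f_gt0 x Ax; rewrite fx0 ltxx.
Qed.

(** The integrand lives on [F], so [m1] may be replaced by its restriction to [F], which [m2]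
    dominates on all measurable sets. *)
Lemma le_measure_integral_pos (m1 m2 : {measure set T -> \bar R})
    (f : T -> \bar R) D F :
    measurable D -> measurable F -> F `<=` D ->
    (forall x, D x -> 0 <= f x)%E -> measurable_fun D f ->
    (forall x, D x -> ~ F x -> f x = 0%E) ->
    (forall A, measurable A -> A `<=` F -> (m1 A <= m2 A)%E) ->
  (\int[m1]_(x in D) f x <= \int[m2]_(x in D) f x)%E.
Proof.
move=> mD mF FD f0 mf fF m12.
have mfF : measurable_fun F f by exact: measurable_funS mf.
have fFE (mu : {measure set T -> \bar R}) :
    (\int[mu]_(x in F) f x = \int[mu]_(x in F) (f \_ F) x)%E.
  by apply: eq_integral => x xF; rewrite patchE xF.
have -> : (\int[m1]_(x in D) f x = \int[m1]_(x in F) f x)%E.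
  rewrite -{1}(setDUK FD) ge0_integral_setU//.
  - by rewrite [X in (_ + X)%E]integral0_eq ?adde0// => x [Dx]; exact: fF.
  - exact: measurableD.
  - by rewrite setDUK.
  - by rewrite setDUK.
  - by apply/disj_setPS => x [Fx []].
apply: (@le_trans _ _ (\int[m2]_(x in F) f x)%E); last first.
  exact: ge0_subset_integral.
rewrite !fFE (eq_measure_integral (mrestr m1 mF)); last first.
  by move=> A mA AF; rewrite /= /mrestr (setIidl AF).
apply: ge0_le_measure_integral => //.
- move=> A mA; rewrite /= /mrestr.
  have mAF := measurableI _ _ mA mF.
  by rewrite (le_trans (m12 _ mAF (@subIsetr _ _ _)))// le_measure ?inE.
- by move=> x; rewrite patchE; case: ifPn => //; rewrite inE => /FD; exact: f0.
- by apply/(measurable_restrictT _ mF).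
Qed.

End measures_from_functions.

(** * The infinity-Wasserstein ball *)

Lemma ultra_fmap (S S' : Type) (f : S -> S') (F : set_system S) :
  UltraFilter F -> UltraFilter (f @ F).
Proof.
move=> FU; split; first exact: fmap_proper_filter.
move=> G GP FG; apply/seteqP; split => // s Gs.
have [//|FnC] := in_ultra_setVsetC (f @^-1` s) FU.
exfalso; apply: (@filter_not_empty _ G).
by rewrite -(setICr s); apply: filterI => //; apply: FG.
Qed.

(** * Bimeasures as limits of near-optimal couplings *)

Section bicoupling.
Context (R : realType) (m : nat) (N : 'rV[R]_m -> R).
Let T := borel_rV R m.
Implicit Types (A B : set T) (P mu : probability T R).

(* A coupling known on rectangles only, b A B being the mass of A `*` B.  Values
   at non-measurable sets are junk. *)
Definition bicoupling P mu (theta : R) (b : set T -> {measure set T -> \bar R})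
    : Prop :=
  [/\ forall B, measurable B -> semi_sigma_additive (b^~ B),
      forall A, measurable A -> b A setT = P A,
      forall B, measurable B -> b setT B = mu B
    & forall A B r, measurable A -> measurable B -> theta < r ->
        (forall x y : 'rV[R]_m, A x -> B y -> r <= N (x - y)) -> b A B = 0%E].

(** Rectangle masses of the couplings lie in [0, 1], so they converge along an ultrafilter. The
    marginals are constant along the sequence, and a rectangle whose sides are separated by more
    than [theta] is eventually null. *)
Lemma bicoupling_of_Winfty P mu theta : (Winfty N P mu <= theta%:E)%E ->
  exists b, bicoupling P mu theta b.
Proof.
move=> Wle.
have Qex (j : nat) : exists Q : probability (T * T)%type R,
    coupling P mu Q /\
    {ae Q, forall z, N ((z.1 : 'rV[R]_m) - (z.2 : 'rV[R]_m)) <= theta + j.+1%:R^-1}.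
  have : (Winfty N P mu < (theta + j.+1%:R^-1)%:E)%E.
    by rewrite (le_lt_trans Wle)// lte_fin ltrDl invr_gt0.
  move/ereal_inf_lt => [_ [Q cQ <-]] /ereal_inf_lt[y yae ylt].
  exists Q; split => //; apply: filterS yae => z zy.
  by rewrite -lee_fin (le_trans zy)// ltW.
have {Qex}[Q QP] := choice Qex.
(* One ultrafilter serves all rectangles at once, which no subsequence could do for uncountably
   many. As it refines the eventual filter, eventual properties survive in the limit. *)
have [U [UU ooU]] := ultraFilterLemma (@eventually_filter).
have UF : ProperFilter U by exact: ultra_proper.
pose q A B j := fine (Q j (A `*` B)).
have mX A B : measurable A -> measurable B -> measurable (A `*` B : set (T * T)).
  by move=> mA mB; exact: measurableX.
have qE A B j : measurable A -> measurable B -> Q j (A `*` B) = (q A B j)%:E.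
  by move=> mA mB; rewrite fineK// fin_num_measure//; exact: mX.
have q_ge0 A B j : 0 <= q A B j by rewrite fine_ge0.
have qleP A B j : measurable A -> measurable B -> ((q A B j)%:E <= P A)%E.
  move=> mA mB; rewrite -qE// -((QP j).1 _ mA).1 /pushforward le_measure ?inE//.
  - exact: mX.
  - by rewrite -[_ @^-1` _]setTI; exact: measurable_fst.
  - by move=> x [].
have qlemu A B j : measurable A -> measurable B -> ((q A B j)%:E <= mu B)%E.
  move=> mA mB; rewrite -qE// -((QP j).1 _ mB).2 /pushforward le_measure ?inE//.
  - exact: mX.
  - by rewrite -[_ @^-1` _]setTI; exact: measurable_snd.
  - by move=> x [].
have lex (p : set T * set T) : exists l : R, measurable p.1 -> measurable p.2 ->
    q p.1 p.2 @ U --> l.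
  have [[m1 m2]|nm] := pselect (measurable p.1 /\ measurable p.2); last first.
    by exists 0 => ? ?; case: nm.
  have := @segment_compact R 0 1; rewrite compact_ultra => /(_ (q p.1 p.2 @ U)).
  case; first exact: ultra_fmap.
    apply: nearW => j /=; rewrite in_itv/= q_ge0/= -lee_fin.
    by rewrite (le_trans (qleP _ _ _ m1 m2))// probability_le1.
  by move=> l [_ ql]; exists l.
have {lex}[l lP] := choice lex.
have l_cvg A B : measurable A -> measurable B -> q A B @ U --> l (A, B).
  by move=> mA mB; exact: (lP (A, B)).
have l_ge0 A B : measurable A -> measurable B -> 0 <= l (A, B).
  by move=> mA mB; apply: (cvgr_to_ge (l_cvg _ _ mA mB)); exact: nearW.
have l_le (c : \bar R) A B : measurable A -> measurable B -> c \is a fin_num ->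
    (forall j, ((q A B j)%:E <= c)%E) -> ((l (A, B))%:E <= c)%E.
  move=> mA mB cfin qc; rewrite -(fineK cfin) lee_fin.
  apply: (cvgr_to_le (l_cvg _ _ mA mB)).
  by apply: nearW => j; rewrite -lee_fin (fineK cfin); exact: qc.
have l_uniq A B (h : nat -> R) x : measurable A -> measurable B -> h @ U --> x ->
    (U (fun j => q A B j = h j)) -> l (A, B) = x.
  move=> mA mB hx qh.
  have qx : q A B @ U --> x.
    by apply: cvg_trans hx; apply: near_eq_cvg; apply: filterS qh => j ->.
  exact: (cvg_unique (@Rhausdorff R) (l_cvg _ _ mA mB) qx).
have qDr A B B' j : measurable A -> measurable B -> measurable B' ->
    B `&` B' = set0 -> q A (B `|` B') j = q A B j + q A B' j.
  move=> mA mB mB' BB'.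
  rewrite /q; have -> : A `*` (B `|` B') = (A `*` B) `|` (A `*` B').
    by apply/seteqP; split => -[x y] /=; tauto.
  rewrite measureU ?fineD ?fin_num_measure//; try exact: mX.
  by rewrite -subset0 => -[x y] /= [[_ Bx] [_ B'x]]; rewrite -[False]/(set0 y) -BB'.
have qDl A A' B j : measurable A -> measurable A' -> measurable B ->
    A `&` A' = set0 -> q (A `|` A') B j = q A B j + q A' B j.
  move=> mA mA' mB AA'.
  rewrite /q; have -> : (A `|` A') `*` B = (A `*` B) `|` (A' `*` B).
    by apply/seteqP; split => -[x y] /=; tauto.
  rewrite measureU ?fineD ?fin_num_measure//; try exact: mX.
  by rewrite -subset0 => -[x y] /= [[Ax _] [A'x _]]; rewrite -[False]/(set0 x) -AA'.
(* Additivity passes to the limit; sigma-additivity then follows because the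
   marginals dominate. *)
have bex A : exists bA : {measure set T -> \bar R}, measurable A ->
    forall B, measurable B -> bA B = (l (A, B))%:E.
  have [mA|nmA] := pselect (measurable A); last by exists mzero.
  have [||B B' mB mB' BB'|bA bAE] :=
    @dominated_additive_measure _ T R mu (fun B => l (A, B)).
  - by move=> B mB; exact: l_ge0.
  - move=> B mB; apply: l_le => //; first exact: fin_num_measure.
    by move=> j; exact: qlemu.
  - apply: l_uniq => //; first exact: measurableU.
      by apply: cvgD; exact: l_cvg.
    by apply: nearW => j; exact: qDr.
  - by exists bA => _.
have {bex}[b bP] := choice bex.
exists b; split.
- move=> B mB.
  have [||A A' mA mA' AA'|bB bBE] :=
    @dominated_additive_measure _ T R P (fun A => l (A, B)).
  + by move=> A mA; exact: l_ge0.
  + move=> A mA; apply: l_le => //; first exact: fin_num_measure.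
    by move=> j; exact: qleP.
  + apply: l_uniq => //; first exact: measurableU.
      by apply: cvgD; exact: l_cvg.
    by apply: nearW => j; exact: qDl.
  + move=> s ms ts mU; rewrite bP// -bBE//.
    under eq_fun do under eq_bigr do rewrite bP// -bBE//.
    exact: measure_semi_sigma_additive.
- move=> A mA; rewrite bP//; apply/eqP; rewrite -(@fineK _ (P A)) ?fin_num_measure//.
  rewrite eqe; apply/eqP; apply: (l_uniq _ _ (cst (fine (P A)))) => //.
    exact: cvg_cst.
  apply: nearW => j; rewrite /q -((QP j).1 _ mA).1 /pushforward; congr (fine (Q j _)).
  by apply/seteqP; split => x //= [].
- move=> A mA; rewrite bP//; apply/eqP; rewrite -(@fineK _ (mu A)) ?fin_num_measure//.
  rewrite eqe; apply/eqP; apply: (l_uniq _ _ (cst (fine (mu A)))) => //.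
    exact: cvg_cst.
  apply: nearW => j; rewrite /q -((QP j).1 _ mA).2 /pushforward; congr (fine (Q j _)).
  by apply/seteqP; split => x //= [].
- move=> A B r mA mB thr sep; rewrite bP//; congr EFin.
  apply: (l_uniq _ _ (cst 0)) => //; first exact: cvg_cst.
  have e0 : 0 < r - theta by rewrite subr_gt0.
  (* As soon as 1/(j+1) < r - theta, the rectangle lies in the null set where the distance bound of
     [Q j] fails. *)
  apply: ooU; near=> j.
  have [_ [M [mM QM0 subM]]] := QP j.
  rewrite /q (@subset_measure0 _ _ _ _ _ M)//; first exact: mX.
  move=> x [/= Ax Bx]; apply: subM => /=; apply/negP; rewrite -ltNge.
  rewrite (lt_le_trans _ (sep _ _ Ax Bx))//.
  by rewrite -ltrBrDl; near: j; exact: (near_infty_natSinv_lt (PosNum e0)).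
Unshelve. all: by end_near. Qed.
End bicoupling.

(** * Countable partitions into cells of small diameter *)

Section small_cells.
Context (R : realType) (m : nat) (N : 'rV[R]_m -> R) (normN : is_norm N).
Let T := borel_rV R m.

(** This half of the equivalence of norms turns cubes of small side into sets of small [N]-diameter;
    it follows by expanding a vector in the standard basis. *)
Lemma is_norm_le_coord : exists2 K, 0 < K &
  forall (x : 'rV[R]_m) (r : R), 0 <= r -> (forall j, `|x ord0 j| <= r) -> N x <= K * r.
Proof.
have [ND NZ _] := normN.
have N0 : N 0 = 0 by rewrite -(scale0r 0) NZ normr0 mul0r.
have N_ge0 x : 0 <= N x.
  have := ND x (-1 *: x); rewrite scaleN1r subrr N0 -scaleN1r NZ normrN1 mul1r.
  lra.
have Nsum (f : 'I_m -> 'rV[R]_m) : N (\sum_j f j) <= \sum_j N (f j).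
  apply: (big_ind2 (fun x y => N x <= y)) => //; first by rewrite N0.
  by move=> x a y b xa yb; rewrite (le_trans (ND _ _))// lerD.
(* The summand 1 keeps the constant positive when m = 0. *)
exists (1 + \sum_j N (delta_mx ord0 j)).
  by rewrite ltr_pwDl// sumr_ge0.
move=> x r r0 xr; rewrite [x]row_sum_delta (le_trans (Nsum _))//.
rewrite mulrDl mul1r mulr_suml ler_wpDl//.
by apply: ler_sum => j _; rewrite NZ mulrC ler_wpM2l.
Qed.

Lemma open_measurable_borel (A : set 'rV[R]_m) : open A -> measurable (A : set T).
Proof. by move=> oA; apply: sub_sigma_algebra. Qed.

Lemma measurable_coord_lt (j : 'I_m) (a : R) :
  measurable ([set x : 'rV[R]_m | x ord0 j < a] : set T).
Proof.
apply: open_measurable_borel.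
apply: (@open_comp _ _ (fun x : 'rV[R]_m => x ord0 j) [set y | y < a]).
  by move=> x _; exact: coord_continuous.
exact: open_lt.
Qed.

(** The cells are the half-open cubes of a grid of side e / K, numbered by coding the integer vector
    of floors; numbers that code no vector get the empty cell. A cube is a finite intersection of
    differences of open half-spaces, hence Borel. *)
Lemma small_cells (e : R) : 0 < e -> exists s : (set T)^nat,
  [/\ forall i, measurable (s i), trivIset setT s, \bigcup_i s i = setT &
      forall i (x y : 'rV[R]_m), s i x -> s i y -> N (x - y) <= e].
Proof.
move=> e0; have [K K0 NK] := is_norm_le_coord.
have [del del0 ->] : exists2 del, 0 < del & e = K * del.
  by exists (e / K); rewrite ?divr_gt0// mulrC divfK// gt_eqF.
pose cell (x : 'rV[R]_m) : 'rV[int]_m := \row_j Num.floor (x ord0 j / del).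
exists (fun i => [set x : T | pickle (cell x) = i]); split.
- move=> i.
  have [[x0 /= <-]|none] := pselect (exists x, pickle (cell x) = i); last first.
    by rewrite (_ : mkset _ = set0)// -subset0 => x xi; apply: none; exists x.
  rewrite (_ : mkset _ = \bigcap_(j in [set: 'I_m])
    ([set x : T | x ord0 j < (Num.floor (x0 ord0 j / del) + 1)%:~R * del] `\`
     [set x : T | x ord0 j < (Num.floor (x0 ord0 j / del))%:~R * del])).
    apply: fin_bigcap_measurable => // j _.
    by apply: measurableD; exact: measurable_coord_lt.
  have E (x : 'rV[R]_m) j : (x ord0 j < (Num.floor (x0 ord0 j / del) + 1)%:~R * del /\
      ~ (x ord0 j < (Num.floor (x0 ord0 j / del))%:~R * del)) <->
      Num.floor (x ord0 j / del) = Num.floor (x0 ord0 j / del).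
    rewrite -ltr_pdivrMr//; split.
      move=> [lt1 /negP]; rewrite -leNgt -ler_pdivlMr// => le1.
      by apply: floor_def; rewrite le1.
    move=> <-; rewrite floorD1_gt; split => //.
    by apply/negP; rewrite -leNgt -ler_pdivlMr// floor_le.
  apply/seteqP; split => x /=.
    by move=> /(pcan_inj pickleK) xx0 j _; apply/E; move/rowP : xx0 => /(_ j); rewrite !mxE.
  by move=> H; congr pickle; apply/rowP => j; rewrite !mxE; apply/E; exact: H.
- by move=> i j _ _ [x /= [<- <-]].
- by apply/seteqP; split => // x _; exists (pickle (cell x)).
- move=> i x y /= <- /(pcan_inj pickleK) /rowP xy.
  apply: NK => [|j]; first exact: ltW.
  move: (xy j); rewrite !mxE => E.
  have := floor_le (x ord0 j / del); have := floorD1_gt (x ord0 j / del).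
  have := floor_le (y ord0 j / del); have := floorD1_gt (y ord0 j / del).
  rewrite E intrD !ler_pdivlMr// !ltr_pdivrMr// => *.
  by rewrite ler_norml; lra.
Qed.

End small_cells.

(** * From bimeasures back to couplings *)

Section coupling_of_bicoupling.
Context (R : realType) (m : nat) (N : 'rV[R]_m -> R) (normN : is_norm N).
Let T := borel_rV R m.
Implicit Types (A B : set T) (P mu : probability T R).

(** It suffices to reach theta + e for every e > 0. Making the coordinates independent above each
    cell preserves both marginals and perturbs distances only by cell diameters. *)
Lemma Winfty_of_bicoupling P mu theta b : bicoupling N P mu theta b ->
  (Winfty N P mu <= theta%:E)%E.
Proof.
move=> [bsa bP bmu bsep]; apply/lee_addgt0Pr => e e0.
have e4 : 0 < e / 4 by rewrite divr_gt0.
have [s [ms ts sT sN]] := small_cells normN e4.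
have b0 B : measurable B -> b set0 B = 0%E.
  move=> mB; apply: (@measure_eq0S _ _ _ _ _ setT) => //.
  by rewrite bP// measure0.
have bsex j : exists nu : {measure set T -> \bar R}, forall A, nu A = b A (s j).
  by apply: exists_measure => //; [exact: b0|exact: bsa].
have {bsex}[bs bsE] := choice bsex.
(* Above the cell [s j], the bimeasure is replaced by the product of [b _ (s j)]
   with the normalized restriction of [mu] ([c j = 0] if [mu (s j) = 0]). *)
pose c j := (fine (mu (s j)))^-1.
have c_ge0 j : 0 <= c j by rewrite invr_ge0 fine_ge0.
pose muj j := mscale (NngNum (c_ge0 j)) (mrestr mu (ms j)).
pose Q0 := mseries (fun j => (bs j \x muj j)%E) 0.
have mX A B : measurable A -> measurable B -> measurable (A `*` B : set (T * T)).
  by move=> mA mB; exact: measurableX.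
have Q0E A B : measurable A -> measurable B ->
    Q0 (A `*` B) = (\sum_(j <oo) b A (s j) * ((c j)%:E * mu (B `&` s j)))%E.
  move=> mA mB; apply: eq_eseriesr => j _.
  rewrite -bsE; exact: product_measure1E.
have muE A : measurable A -> mu A = (fine (mu A))%:E.
  by move=> mA; rewrite fineK// fin_num_measure.
have c1 j : mu (s j) = 0%E \/ ((c j)%:E * mu (s j) = 1)%E.
  rewrite (muE (s j))// -EFinM /c; have [->|?] := eqVneq (fine (mu (s j))) 0.
    by left.
  by right; rewrite mulVf.
have bs0 A j : measurable A -> mu (s j) = 0%E -> b A (s j) = 0%E.
  move=> mA muj0; rewrite -bsE; apply: (@measure_eq0S _ _ _ _ _ setT) => //.
  by rewrite bsE bmu.
have bigcupE (nu : {measure set T -> \bar R}) (F : (set T)^nat) :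
    (forall i, measurable (F i)) -> trivIset setT F ->
    nu (\bigcup_i F i) = (\sum_(i <oo) nu (F i))%E.
  move=> mF tF; apply/esym/cvg_lim => //.
  by apply: measure_semi_sigma_additive => //; exact: bigcup_measurable.
have Q0fst A : measurable A -> Q0 (A `*` setT) = P A.
  move=> mA; rewrite Q0E// -bP// -[in RHS]sT bigcupE//.
  apply: eq_eseriesr => j _.
  rewrite setTI.
  by have [muj0|->] := c1 j; rewrite ?mule1// bs0// mul0e.
have Q0snd B : measurable B -> Q0 (setT `*` B) = mu B.
  move=> mB; rewrite Q0E// -[in RHS](setIT B) -[in RHS]sT setI_bigcupr bigcupE//.
  - apply: eq_eseriesr => j _.
    rewrite bmu//.
    have [muj0|cj] := c1 j; last by rewrite muleA (muleC (mu _)) cj mul1e.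
    rewrite muj0 mul0e; apply/esym.
    by apply: (@measure_eq0S _ _ _ _ _ (s j)) => //; exact: measurableI.
  - by move=> j; exact: measurableI.
  - exact: trivIset_setIl.
have Q0T : Q0 setT = 1%E by rewrite -setXTT Q0fst// probability_setT.
have [Q QE] := exists_probability Q0T.
(* A union of whole cells is measurable, and the rectangles [D j] times [s j] cover all pairs
   farther apart than theta + e. It remains to see that each of them is null. *)
pose D j := \bigcup_(i in [set i | exists x y : 'rV[R]_m,
  [/\ s i x, s j y & theta + e < N (x - y)]]) s i.
have mD j : measurable (D j) by apply: bigcup_measurable => i _.
have [ND NZ _] := normN.
have NC x y : N (x - y) = N (y - x).
  by rewrite -opprB -scaleN1r NZ normrN1 mul1r.
have bD j : b (D j) (s j) = 0%E.
  (* Each of the two cells costs at most e / 4, so all their points are still farther apart than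
     theta + e / 2. *)
  apply: (bsep _ _ (theta + e / 4)) => //; first by rewrite ltrDl.
  move=> x y [i [x' [y' [six' sjy' lt]]] six] sjy.
  have := ND (x' - x) (x - y'); rewrite addrA subrK.
  have := ND (x - y) (y - y'); rewrite addrA subrK.
  by have := sN _ _ _ six' six; have := sN _ _ _ sjy sjy'; lra.
have QD j : Q (D j `*` s j) = 0%E.
  rewrite (etrans (QE _) (Q0E _ _ _ _))// eseries0// => k _ _.
  have [->|kj] := eqVneq k j; first by rewrite bD mul0e.
  rewrite (_ : s j `&` s k = set0) ?measure0 ?mule0//.
  apply/eqP; apply: contraNT kj => /set0P sjk.
  by rewrite (ts j k).
apply: (@le_trans _ _ (ess_sup Q
  (fun z : T * T => (N ((z.1 : 'rV[R]_m) - (z.2 : 'rV[R]_m)))%:E))).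
  apply: ereal_inf_lbound; exists Q => // A mA; split.
    by rewrite -Q0fst// setXT; exact: QE.
  by rewrite -Q0snd// setTX; exact: QE.
apply: ereal_inf_lbound => /=.
have Qneg j : Q.-negligible (D j `*` s j).
  by exists (D j `*` s j); split => //; exact: (mX _ _ (mD j) (ms j)).
have := negligible_bigcup Qneg; apply: negligibleS.
move=> [x y] /= /negP; rewrite lee_fin -ltNge => ltxy.
have [[i _ six] [j _ sjy]] : (\bigcup_i s i) x /\ (\bigcup_i s i) y by rewrite sT.
by exists j => //; split => //; exists i => //; exists x, y.
Qed.

End coupling_of_bicoupling.

(** * Merging two members of the ball *)

Section merge.
Context (R : realType) (m : nat) (N : 'rV[R]_m -> R).
Let T := borel_rV R m.
Implicit Types (A B : set T) (P mu : probability T R).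

Lemma bicoupling_slice P mu theta b : bicoupling N P mu theta b ->
  forall B, measurable B -> exists nu : {measure set T -> \bar R},
    forall A, nu A = b A B.
Proof.
move=> [bsa bP _ _] B mB; apply: exists_measure => //; last exact: bsa.
apply: (measure_eq0S mB measurableT) => //.
by rewrite bP// measure0.
Qed.

Lemma bicoupling_le P mu theta b A A' B : bicoupling N P mu theta b ->
  measurable A -> measurable A' -> measurable B -> A `<=` A' ->
  (b A B <= b A' B)%E.
Proof.
move=> bb mA mA' mB AA'; have [nu nuE] := bicoupling_slice bb mB.
by rewrite -!nuE le_measure// inE.
Qed.

Lemma bicoupling_le_mu P mu theta b A B : bicoupling N P mu theta b ->
  measurable A -> measurable B -> (b A B <= mu B)%E.
Proof.
move=> bb mA mB; have [_ _ <-// _] := bb.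
exact: bicoupling_le bb mA measurableT mB (@subsetT _ _).
Qed.

Lemma bicoupling_setDl P mu theta b F B : bicoupling N P mu theta b ->
  measurable F -> measurable B -> (b F B + b (~` F) B = mu B)%E.
Proof.
move=> bb mF mB; have [_ _ <-// _] := bb.
have [nu nuE] := bicoupling_slice bb mB.
rewrite -!nuE -measureU ?setUv//; first exact: measurableC.
exact: setICr.
Qed.

Lemma bicoupling_setDr P mu theta b A S : bicoupling N P mu theta b ->
  measurable A -> measurable S -> (b A (~` S) + b A S = P A)%E.
Proof.
move=> [_ bP _ _] mA mS; rewrite -bP// -measureU ?setvU//; first exact: measurableC.
exact: setICl.
Qed.

(* Where [S] holds, the mass that [b1] puts outside [F] is replaced by a multiple,
   depending on the second coordinate only, of the mass that [b0] puts on [F]; [S]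
   is the set of second coordinates above which [b0] charges [F]. *)
Lemma bicoupling_merge P0 P1 mu theta b0 b1 F : measurable F ->
    bicoupling N P0 mu theta b0 -> bicoupling N P1 mu theta b1 ->
  exists P b, [/\ bicoupling N P mu theta b,
    (P0 F <= P F)%E,
    forall A, measurable A -> A `<=` F -> (P1 A <= P A)%E &
    forall A, measurable A -> P0 A = 0%E -> P1 A = 0%E -> P A = 0%E].
Proof.
move=> mF bb0 bb1.
have mFc := measurableC mF.
have muoo : (mu setT < +oo)%E by rewrite probability_setT ltry.
have [|//|A mA muA0|q0 [q0_ge0 mq0 q0E]] := @exists_density _ _ _ (b0 F) mu.
- by rewrite (le_lt_trans (bicoupling_le_mu bb0 _ _)).
- by apply/eqP; rewrite -measure_le0 -muA0 (bicoupling_le_mu bb0).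
pose S := [set x | (0 < q0 x)%E].
have mS : measurable S.
  by rewrite -[S]setTI; exact: emeasurable_fun_o_infty.
have mSc := measurableC mS.
(* Absolute continuity: if [b0 F] vanishes on A, then positivity of [q0] on [S] makes A intersected
   with [S] a [mu]-null set, and [mu] dominates the mass that [b1] puts outside [F]. *)
have [|||r [r_ge0 mr rE]] := @exists_density _ _ _ (mrestr (b1 (~` F)) mS) (b0 F).
- rewrite /= /mrestr setTI.
  by rewrite (le_lt_trans (bicoupling_le_mu bb1 _ _))// -ge0_fin_numE// fin_num_measure.
- by rewrite (le_lt_trans (bicoupling_le_mu bb0 _ _)).
- move=> A mA b0FA; rewrite /= /mrestr.
  have mAS : measurable (A `&` S) by exact: measurableI.
  apply/eqP; rewrite -measure_le0.
  rewrite (le_trans (bicoupling_le_mu bb1 mFc mAS))//.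
  rewrite (integral_eq0_pos mAS (measurable_funTS mq0))//; first by move=> x [].
  rewrite -q0E//.
  exact: (measure_eq0S mAS mA _ b0FA).
have [dn dnE] := choice (fun nu => exists_measure_density nu r_ge0 mr).
(* For A = [setT] the [r]-weighted term restores exactly the mass removed from the complement of [F]
   above [S], so the second marginal remains [mu]. *)
pose b A : {measure set T -> \bar R} := measure_add (mrestr (b1 A) mSc)
  (measure_add (mrestr (b1 (A `&` F)) mS) (dn (b0 (A `&` F)))).
have bE A B : b A B = (b1 A (B `&` ~` S) +
    (b1 (A `&` F) (B `&` S) + \int[b0 (A `&` F)]_(x in B) r x))%E.
  apply: etrans (measure_addE _ _ _) _; congr (_ + _)%E.
  by apply: etrans (measure_addE _ _ _) _; congr (_ + _)%E; exact: dnE.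
have bsl B : measurable B -> exists rho : {measure set T -> \bar R},
    forall A, rho A = b A B.
  move=> mB.
  have [n1 n1E] := bicoupling_slice bb1 (measurableI _ _ mB mSc).
  have [n2 n2E] := bicoupling_slice bb1 (measurableI _ _ mB mS).
  have [||n3 n3E] := @exists_measure_integral _ _ _ (b0) r B mB r_ge0 mr.
  - move=> C mC; have [n nE] := bicoupling_slice bb0 mC.
    by rewrite -nE measure0.
  - by case: bb0.
  exists (measure_add n1 (measure_add (mrestr n2 mF) (mrestr n3 mF))) => A.
  rewrite bE; apply: etrans (measure_addE _ _ _) _; congr (_ + _)%E => //.
  by apply: etrans (measure_addE _ _ _) _; congr (_ + _)%E; [exact: n2E|exact: n3E].
have bT B : measurable B -> b setT B = mu B.
  move=> mB; rewrite bE !setTI -rE// /= /mrestr.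
  have [_ _ bmu1 _] := bb1.
  rewrite (bicoupling_setDl bb1)//; last exact: measurableI.
  rewrite bmu1; last exact: measurableI.
  rewrite -measureU// -?setIUr ?setvU ?setIT//.
  - exact: measurableI.
  - exact: measurableI.
  - by rewrite -setIIr setICl setI0.
have [rho rhoE] := bsl _ measurableT.
have [|P PE] := @exists_probability _ _ _ rho.
  by rewrite rhoE bT// probability_setT.
have PbE A : P A = b A setT by exact: etrans (PE _) (rhoE _).
exists P, b; split.
- split => //.
  + move=> B mB; have [n nE] := bsl _ mB.
    have -> : b^~ B = n by apply/funext => A; rewrite nE.
    exact: measure_semi_sigma_additive.
  + move=> A B s mA mB ths sep; rewrite bE.
    have [_ _ _ sep0] := bb0; have [_ _ _ sep1] := bb1.
    have mAF := measurableI _ _ mA mF.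
    rewrite (sep1 _ _ s mA (measurableI _ _ mB mSc))//; last first.
      by move=> x y Ax [By _]; exact: sep.
    rewrite (sep1 _ _ s mAF (measurableI _ _ mB mS))//; last first.
      by move=> x y [Ax _] [By _]; exact: sep.
    rewrite null_set_integral ?adde0//; first exact: measurable_funTS.
    by rewrite (sep0 _ _ s mAF mB)// => x y [Ax _]; exact: sep.
(* Above [S] the whole [mu]-mass is now carried by [F], while [b0 F] charges nothing outside [S],
   where [q0] vanishes: P0 F = b0 F S <= mu S <= P F. *)
- rewrite PbE bE setIid !setTI -rE// /= /mrestr setTI.
  rewrite (bicoupling_setDl bb1)//.
  rewrite -(bicoupling_setDr bb0 mF mS) [X in (X + _)%E](_ : _ = 0%E); last first.
    rewrite q0E// integral0_eq// => x /= /negP; rewrite -leNgt => q0x.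
    by apply/eqP; rewrite eq_le q0x q0_ge0.
  by rewrite add0e (le_trans (bicoupling_le_mu bb0 mF mS))// leeDr.
- move=> A mA AF; rewrite PbE bE (setIidl AF) !setTI -(bicoupling_setDr bb1 mA mS).
  by rewrite leeD2l// leeDl// integral_ge0.
- move=> A mA P0A P1A; rewrite PbE bE !setTI.
  have mAF := measurableI _ _ mA mF.
  have [_ bP0 _ _] := bb0; have [_ bP1 _ _] := bb1.
  have b1A B : measurable B -> b1 A B = 0%E.
    by move=> mB; apply: (measure_eq0S mB measurableT) => //; rewrite bP1.
  rewrite b1A// null_set_integral//.
  + rewrite (_ : b1 _ _ = 0%E) ?adde0//.
    apply/eqP; rewrite -measure_le0 -(b1A S)//.
    by apply: (bicoupling_le bb1) => // x [].
  + apply/eqP; rewrite -measure_le0 -P0A -bP0//.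
    by apply: (bicoupling_le bb0) => // x [].
Qed.

Lemma Winfty_ball_merge (normN : is_norm N) (Xi : set T) mu theta P0 P1 F :
    measurable Xi -> measurable F ->
    Winfty_ball N Xi mu theta P0 -> Winfty_ball N Xi mu theta P1 ->
  exists P, [/\ Winfty_ball N Xi mu theta P, (P0 F <= P F)%E &
    forall A, measurable A -> A `<=` F -> (P1 A <= P A)%E].
Proof.
move=> mXi mF [P0Xi /bicoupling_of_Winfty[b0 bb0]].
move=> [P1Xi /bicoupling_of_Winfty[b1 bb1]].
have [P [b [bb PF PA PN]]] := bicoupling_merge mF bb0 bb1.
exists P; split => //; split; last exact: Winfty_of_bicoupling bb.
have mXic := measurableC mXi.
(* The complement of [Xi] is null for [P0] and [P1], hence for the merged [P]. *)
rewrite -(setCK Xi) probability_setC// PN ?sube0//.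
- by rewrite probability_setC// P0Xi subee.
- by rewrite probability_setC// P1Xi subee.
Qed.

End merge.

(** * Expected losses *)

Section max_pos_theory.
Context (R : realType) (k : nat).
Implicit Types f : 'I_k -> R.

Lemma max_pos_ge0 f : 0 <= max_pos f.
Proof.
rewrite /max_pos; elim/big_rec: _ => // i x _ x0.
by rewrite le_max x0 orbT.
Qed.

Lemma le_max_pos f i : f i <= max_pos f.
Proof. by rewrite /max_pos (bigD1 i)//= !le_max lexx. Qed.

Lemma max_pos_le f a : 0 <= a -> (forall i, f i <= a) -> max_pos f <= a.
Proof.
move=> a0 fa; rewrite /max_pos; elim/big_rec: _ => // i x _ x0.
by rewrite !ge_max fa a0.
Qed.

Lemma max_pos_gt0P f : reflect (exists i, 0 < f i) (0 < max_pos f).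
Proof.
apply: (iffP idP) => [|[i fi]]; last exact: lt_le_trans fi (le_max_pos f i).
move=> f0; apply/not_existsP => nf.
have : max_pos f <= 0 by apply: max_pos_le => // i; rewrite leNgt; exact/negP/nf.
by rewrite leNgt f0.
Qed.

Lemma measurable_max_pos d (T : measurableType d) (D : set T)
    (f : 'I_k -> T -> R) : (forall i, measurable_fun D (f i)) ->
  measurable_fun D (fun x => max_pos (f^~ x)).
Proof.
move=> mf; rewrite /max_pos; elim: (index_enum _) => [|i s IH].
  by under eq_fun do rewrite big_nil; exact: measurable_cst.
under eq_fun do rewrite big_cons.
by apply: measurable_maxr => //; exact: measurable_maxr.
Qed.

End max_pos_theory.

Section cvar_bound.
Context d (T : measurableType d) (R : realType) (k : nat).
Context (P : probability T R) (D : set T) (mD : measurable D).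

(* With [F] the positivity set, pointwise
   max_pos h + lam b^- 1_F <= (1 - lam) max_pos u + lam max_pos (v - b) + lam b^+. *)
Lemma integral_max_pos_convex_le (u v : 'I_k -> T -> R) (lam eps w : R) :
    0 < lam < 1 -> 0 < eps < 1 ->
    (forall i, measurable_fun D (u i)) -> (forall i, measurable_fun D (v i)) ->
    let h i x := (1 - lam) * u i x + lam * v i x in
    (eps%:E <= P (D `&` [set x | (0 < max_pos (h^~ x))%R]))%E ->
    (ereal_inf [set (b%:E + (eps^-1)%:E *
        \int[P]_(x in D) (max_pos (fun i => (v i x - b)%R))%:E)%E
      | b in [set: R]] <= 0)%E ->
    (\int[P]_(x in D) (max_pos (u^~ x))%:E <= w%:E)%E ->
  (\int[P]_(x in D) (max_pos (h^~ x))%:E <= ((1 - lam) * w)%:E)%E.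
Proof.
move=> /andP[lam0 lam1] /andP[eps0 eps1] mu mv h epsP cvar_le0 intu_le.
set F := D `&` _ in epsP.
have mh i : measurable_fun D (h i).
  by apply: measurable_funD; exact: measurable_funM.
have mmh := measurable_max_pos mh.
have mF : measurable F.
  have := mmh mD `]0, +oo[%classic (measurable_itv _).
  by rewrite preimage_itvoy.
apply/lee_addgt0Pr => e e0.
(* The tolerance is e / (2 lam) because, when b >= 0, both b and the integral [Ib] may be as large
   as the tolerance, and both enter with the factor lam. *)
have [_ [b _ <-]] : exists2 y, [set (b%:E + (eps^-1)%:E *
      \int[P]_(x in D) (max_pos (fun i => (v i x - b)%R))%:E)%E
    | b in [set: R]] y & (y < (e / (2 * lam))%:E)%E.
  by apply: ereal_inf_lt; rewrite (le_lt_trans cvar_le0)// lte_fin divr_gt0// mulr_gt0.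
set Ib := (\int[P]_(x in D) _)%E => Ib_lt.
have mvb i : measurable_fun D (fun x => v i x - b).
  by apply: measurable_funB => //; exact: measurable_cst.
have Ib0 : (0 <= Ib)%E by apply: integral_ge0 => x _; rewrite lee_fin max_pos_ge0.
have Ib_fin : Ib \is a fin_num.
  rewrite ge0_fin_numE// ltNge leye_eq; apply/negP => /eqP Iboo.
  by move: Ib_lt; rewrite Iboo gt0_muley ?lte_fin ?invr_gt0// addey.
(* Placing b^+ and b^- on opposite sides keeps all integrands nonnegative, so that integrals add
   without integrability. *)
pose bp := Num.max b 0; pose bn := Num.max (- b) 0.
have bp0 : 0 <= bp by rewrite le_max lexx orbT.
have bn0 : 0 <= bn by rewrite le_max lexx orbT.
have pw x : D x -> max_pos (h^~ x) + lam * bn * \1_F x <=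
    (1 - lam) * max_pos (u^~ x) + lam * max_pos (fun i => v i x - b) + lam * bp.
  move=> Dx.
  have u0 := max_pos_ge0 (u^~ x); have v0 := max_pos_ge0 (fun i => v i x - b).
  have hle i : h i x <=
      (1 - lam) * max_pos (u^~ x) + lam * max_pos (fun i => v i x - b) + lam * b.
    have := le_max_pos (u^~ x) i; have := le_max_pos (fun i => v i x - b) i.
    by rewrite /h /=; nra.
  have bE : b = bp - bn.
    by rewrite /bp /bn; case: (leP b 0); case: (leP (-b) 0); lra.
  have [Fx|nFx] := pselect (F x); last first.
    rewrite indicE memNset// mulr0 addr0 (_ : max_pos _ = 0)//.
      by nra.
    apply/eqP; rewrite eq_le max_pos_ge0 andbT leNgt; apply/negP => hx.
    exact: nFx.
  rewrite indicE mem_set// mulr1.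
  have [i hi0] : exists i, 0 < h i x by apply/max_pos_gt0P; case: Fx.
  suff : max_pos (h^~ x) <= (1 - lam) * max_pos (u^~ x) +
    lam * max_pos (fun i => v i x - b) + lam * b by rewrite bE; nra.
  by apply: max_pos_le => //; rewrite (le_trans _ (hle i))// ltW.
have meas1 : measurable_fun D (fun x => lam * bn * \1_F x).
  by apply: measurable_funM => //; exact: measurable_funTS.
have int_le : (\int[P]_(x in D) (max_pos (h^~ x))%:E + (lam * bn)%:E * P F <=
    (1 - lam)%:E * \int[P]_(x in D) (max_pos (u^~ x))%:E + lam%:E * Ib +
    (lam * bp)%:E * P D)%E.
  have m1 : measurable_fun D (fun x => (max_pos (h^~ x))%:E) by exact/measurable_EFinP.
  have m2 : measurable_fun D (fun x => (lam * bn * \1_F x)%:E) by exact/measurable_EFinP.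
  have m3 : measurable_fun D (fun x => ((1 - lam) * max_pos (u^~ x))%:E).
    by apply/measurable_EFinP; apply: measurable_funM => //; exact: measurable_max_pos.
  have m4 : measurable_fun D (fun x => (lam * max_pos (fun i => v i x - b))%:E).
    by apply/measurable_EFinP; apply: measurable_funM => //; exact: measurable_max_pos.
  have m5 : measurable_fun D (fun x => (lam * bp)%:E : \bar R) by exact: measurable_cst.
  have lam1' : 0 <= 1 - lam by lra.
  have lbn : 0 <= lam * bn by rewrite mulr_ge0// ltW.
  have lbp : 0 <= lam * bp by rewrite mulr_ge0// ltW.
  have Zl (a : R) (f : T -> R) : 0 <= a -> (forall x, 0 <= f x) ->
      measurable_fun D f ->
      (a%:E * \int[P]_(x in D) (f x)%:E = \int[P]_(x in D) (a * f x)%:E)%E.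
    move=> a0 f0 mf; rewrite -ge0_integralZl_EFin//.
    - by move=> x _; rewrite lee_fin.
    - exact/measurable_EFinP.
  have -> : P F = (\int[P]_(x in D) (\1_F x)%:E)%E.
    by rewrite integral_indic// (setIidl _)//; exact: subIsetl.
  have -> : ((lam * bp)%:E * P D = \int[P]_(x in D) (lam * bp)%:E)%E.
    by rewrite integral_cst.
  rewrite !Zl//; try exact: measurable_max_pos; try exact: ltW;
    try (by move=> x; exact: max_pos_ge0).
  have p1 x : 0 <= max_pos (h^~ x) by exact: max_pos_ge0.
  have p2 x : 0 <= lam * bn * \1_F x by rewrite mulr_ge0.
  have p3 x : 0 <= (1 - lam) * max_pos (u^~ x) by rewrite mulr_ge0 ?max_pos_ge0.
  have p4 x : 0 <= lam * max_pos (fun i => v i x - b).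
    by rewrite mulr_ge0 ?max_pos_ge0// ltW.
  rewrite -!ge0_integralD//; try (by move=> x _; rewrite lee_fin).
  - apply: ge0_le_integral => //.
    + by move=> x _; rewrite lee_fin addr_ge0.
    + exact: emeasurable_funD.
    + by apply: emeasurable_funD => //; exact: emeasurable_funD.
  - by move=> x _; rewrite lee_fin addr_ge0.
  - exact: emeasurable_funD.
have del0 : 0 < e / (2 * lam) by rewrite divr_gt0// mulr_gt0.
have eE : e = 2 * lam * (e / (2 * lam)).
  by rewrite mulrC divfK// gt_eqF// mulr_gt0.
have PF_fin : P F \is a fin_num by rewrite fin_num_measure.
have := epsP; rewrite -(fineK PF_fin) lee_fin => eps_p.
have ib : b + eps^-1 * fine Ib < e / (2 * lam).
  by move: Ib_lt; rewrite -{1}(fineK Ib_fin) -EFinM -EFinD lte_fin.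
move: del0 eE ib; set del := e / _ => del0 eE ib.
have i0 : 0 <= fine Ib by exact: fine_ge0.
apply: (@le_trans _ _ (((1 - lam) * w + lam * fine Ib + lam * bp)%:E -
    (lam * bn * fine (P F))%:E)%E).
  rewrite leeBrDr// EFinM (fineK PF_fin) (le_trans int_le)//.
  rewrite !EFinD !EFinM (fineK Ib_fin) leeD//.
    by rewrite leeD2r// lee_pmul2l// lte_fin subr_gt0.
  rewrite -EFinM -[leRHS]mule1; apply: lee_wpmul2l; last exact: probability_le1.
  by rewrite lee_fin mulr_ge0// ltW.
rewrite -EFinB -EFinD lee_fin eE.
have i_le : fine Ib <= eps * (del - b).
  by rewrite -ler_pdivrMl//; lra.
suff : fine Ib + bp - bn * fine (P F) <= 2 * del.
  by move=> /(ler_wpM2l (ltW lam0)); lra.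
have epsdel : eps * del <= del by rewrite ger_pMl// ltW.
have [b0|b0] := leP 0 b.
  have -> : bp = b by rewrite /bp max_l.
  have -> : bn = 0 by rewrite /bn max_r// oppr_le0.
  have : 0 <= eps * b by rewrite mulr_ge0// ltW.
  have : 0 <= eps^-1 * fine Ib by rewrite mulr_ge0// invr_ge0 ltW.
  lra.
have -> : bp = 0 by rewrite /bp max_r// ltW.
have -> : bn = - b by rewrite /bn max_l// oppr_ge0 ltW.
(* For b < 0 the gain of b^- on [F] pays for the term - eps * b in [i_le]; this is where P F >= eps
   enters. *)
have : b * (fine (P F) - eps) <= 0 by rewrite mulr_le0_ge0 ?subr_ge0// ltW.
lra.
Qed.

End cvar_bound.

Lemma le_dotp_convex (R : realType) (n : nat) (c x y : 'rV[R]_n) (lam t : R) :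
  0 <= lam <= 1 -> dotp c x <= t -> dotp c y <= t ->
  dotp c (lam *: x + (1 - lam) *: y) <= t.
Proof.
move=> /andP[lam0 lam1] cx cy.
have -> : dotp c (lam *: x + (1 - lam) *: y) =
    lam * dotp c x + (1 - lam) * dotp c y.
  rewrite /dotp !mulr_sumr -big_split/=; apply: eq_bigr => j _.
  by rewrite !mxE; ring.
by nra.
Qed.

(** Where some u i is positive, n * u i + v i is positive for large n. Continuity from below gives
    an n for which this already happens with probability > eps. *)
Lemma convex_combination_prob (d : measure_display) (T : measurableType d)
    (R : realType) (k : nat) (P : probability T R) (D : set T)
    (u v : 'I_k -> T -> R) (eps : R) : measurable D ->
    (forall i, measurable_fun D (u i)) -> (forall i, measurable_fun D (v i)) ->
    (eps%:E < P (D `&` [set x | (0 < max_pos (u^~ x))%R]))%E ->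
  exists2 lam, 0 < lam < 1 & (eps%:E <= P (D `&`
    [set x | (0 < max_pos (fun i => (1 - lam) * u i x + lam * v i x))%R]))%E.
Proof.
move=> mD mu mv Pu.
have msup (f : 'I_k -> T -> R) : (forall i, measurable_fun D (f i)) ->
    measurable (D `&` [set x | 0 < max_pos (f^~ x)]).
  move=> mf; have := measurable_max_pos mf mD (measurable_itv `]0, +oo[).
  by rewrite preimage_itvoy.
(* The minimum is positive exactly when both terms are; requiring u i > 0 makes the events [E n]
   increase with n. *)
pose f n i x : R := Num.min (u i x) (n%:R * u i x + v i x).
have mf n i : measurable_fun D (f n i).
  apply: measurable_minr => //; apply: measurable_funD => //.
  exact: measurable_funM.
pose E n := D `&` [set x | 0 < max_pos ((f n)^~ x)].
have fP n i x : 0 < f n i x <-> 0 < u i x /\ 0 < n%:R * u i x + v i x.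
  by rewrite /f lt_min; split => [/andP|[-> ->]].
have ndE : nondecreasing_seq E.
  move=> a b ab; apply/subsetPset => x [Dx /max_pos_gt0P[i /fP[ui uvi]]].
  split => //; apply/max_pos_gt0P; exists i; apply/fP; split => //.
  by rewrite (lt_le_trans uvi)// lerD2r ler_pM2r// ler_nat.
have UE : \bigcup_n E n = D `&` [set x | 0 < max_pos (u^~ x)].
  apply/seteqP; split => x.
    move=> [a _ [Dx /max_pos_gt0P[i /fP[ui _]]]].
    by split => //; apply/max_pos_gt0P; exists i.
  move=> [Dx /max_pos_gt0P[i ui]].
  pose a := Num.bound `|- v i x / u i x|.
  exists a => //; split => //; apply/max_pos_gt0P; exists i; apply/fP; split => //.
  rewrite -ltrBlDr sub0r -ltr_pdivrMr//.
  exact: le_lt_trans (ler_norm _) (archi_boundP (normr_ge0 _)).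
have PE : P (E n) @[n --> \oo] --> P (\bigcup_n E n).
  have mE a : measurable (E a) by exact: msup.
  by apply: nondecreasing_cvg_mu => //; exact: bigcup_measurable.
have [a epsE] : exists a, (eps%:E < P (E a))%E.
  apply/not_existsP => nE; move: Pu; rewrite -UE ltNge => /negP; apply.
  rewrite -(cvg_lim _ PE)//; apply: lime_le; first by apply/cvg_ex; eexists; exact: PE.
  by apply: nearW => a; rewrite leNgt; apply/negP; exact: nE.
(* Multiplied by a + 2, the combination becomes (a + 1) * u i + v i, which exceeds a * u i + v i.
   The shift by 2 gives lam < 1 even for a = 0. *)
exists a.+2%:R^-1.
  by rewrite invr_gt0 ltr0n/= invf_lt1 ?ltr0n// ltr1n.
rewrite (le_trans (ltW epsE))// le_measure ?inE//; first exact: msup.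
  apply: msup => i; apply: measurable_funD; exact: measurable_funM.
move=> x [Dx /max_pos_gt0P[i /fP[ui uvi]]]; split => //.
apply/max_pos_gt0P; exists i.
have a0 : 0 < a.+2%:R :> R by rewrite ltr0n.
rewrite -(pmulr_rgt0 _ a0) mulrDr !mulrA mulrBr divff ?gt_eqF// mulr1 mul1r.
rewrite -addn2 natrD; nra.
Qed.

Lemma i01_of (R : numDomainType) (lam : R) : 0 <= lam <= 1 ->
  exists t : {i01 R}, t%:num = lam.
Proof. by move=> /andP[l0 l1]; exists (Itv01 l0 l1). Qed.

Theorem theorem6 (R : realType) (n m k : nat)
  (N : 'rV[R]_m -> R) (Xi : set (borel_rV R m))
  (g : 'I_k -> 'rV[R]_n -> 'rV[R]_m -> R)
  (X C : set 'rV[R]_n) (c : 'rV[R]_n) (eps theta : R)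
  (mu : probability (borel_rV R m) R)
  (k_gt0 : (0 < k)%N)
  (normN : is_norm N)
  (eps01 : 0 < eps < 1)
  (theta_ge0 : 0 <= theta)
  (mXi : measurable Xi)
  (muXi : mu Xi = 1%E)
  (mu_subgauss : sub_gaussian N mu)
  (g_convex : forall i xi, Xi xi ->
     @convex_function R 'rV[R]_n setT (fun x => g i x xi))
  (g_lsc : forall i xi, Xi xi ->
     lower_semicontinuous (fun x : 'rV[R]_n => (g i x xi)%:E))
  (g_meas : forall i x, measurable_fun Xi (g i x : borel_rV R m -> R))
  (gbar_max : forall i x zeta, Xi zeta ->
     exists2 xi : 'rV[R]_m, Xi xi /\ N (xi - zeta) <= theta &
       forall xi' : 'rV[R]_m, Xi xi' -> N (xi' - zeta) <= theta ->
         g i x xi' <= g i x xi)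
  (X_neq0 : X !=set0)
  (X_closed : closed X)
  (X_convex : convex_set (X : set (convex_lmodType 'rV[R]_n)))
  (C_cone : closed_pointed_convex_cone C)
  (X_sub_C : X `<=` C)
  (c_dual : ((dual_cone C)° `|` [set 0]) c)
  (program_feasible :
     drccp_feasible g Xi (Winfty_ball N Xi mu theta) eps X !=set0)
  (lower_attained : forall t, lower_feasible X c t !=set0 ->
     exists2 x, lower_argmin g Xi (Winfty_ball N Xi mu theta) X c t x &
       worst_loss g Xi (Winfty_ball N Xi mu theta) x \is a fin_num) :
  (alsox_value g Xi (Winfty_ball N Xi mu theta) eps X c <=
   cvar_value g Xi (Winfty_ball N Xi mu theta) eps X c)%E.
Proof.
apply: le_ereal_inf_tmp => _ [x0 [Xx0 cvx0] <-].
apply: ereal_inf_lbound; exists (dotp c x0) => //; split; first by exists x0.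
move=> xs [[Xxs cxs] xs_min].
rewrite /robust_chance leNgt; apply/negP => /ereal_inf_lt[_ [P0 P0ball <-] P0lt].
set PP := Winfty_ball _ _ _ _ in cvx0 xs_min lower_attained P0ball *.
have mmp i x b : measurable_fun Xi (fun xi : borel_rV R m => g i x xi - b).
  by apply: measurable_funB => //; exact: g_meas.
have mg x : measurable_fun Xi (fun xi : borel_rV R m => max_pos (fun i => g i x xi)).
  exact: (@measurable_max_pos R k _ (borel_rV R m) Xi (fun i => g i x) (g_meas^~ x)).
pose Fs : set (borel_rV R m) := Xi `&` [set xi | (0 < max_pos (fun i => g i xs xi))%R].
have mpos (f : borel_rV R m -> R) : measurable_fun Xi f ->
    measurable (Xi `&` [set xi | (0 < f xi)%R]).
  by move=> /(_ mXi `]0, +oo[%classic (measurable_itv _)); rewrite preimage_itvoy.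
have P0Fs : (eps%:E < P0 Fs)%E.
  pose G : set (borel_rV R m) := [set xi | Xi xi /\ forall i, g i xs xi <= 0].
  have GE : G = Xi `\` Fs.
    apply/seteqP; split => xi [Xxi].
      move=> gle; split => // -[_ /max_pos_gt0P[i]].
      by rewrite ltNge gle.
    move=> nF; split => // i; rewrite leNgt; apply/negP => gi; apply: nF.
    by split => //; apply/max_pos_gt0P; exists i.
  have mFs : measurable Fs by exact: mpos (mg xs).
  have mG : measurable G by rewrite GE; exact: measurableD.
  have : (P0 G + P0 Fs = 1)%E.
    rewrite -P0ball.1 -measureU//; last by rewrite GE setDKI.
    by rewrite GE setUC setDUK//; exact: subIsetl.
  have Gfin : P0 G \is a fin_num by rewrite fin_num_measure.
  have Ffin : P0 Fs \is a fin_num by rewrite fin_num_measure.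
  move: P0lt; rewrite -/G -(fineK Gfin) -(fineK Ffin) -EFinD !lte_fin => P0lt [].
  lra.
have [lam /andP[lam0 lam1] P0F] := convex_combination_prob mXi
  (fun i => g_meas i xs) (fun i => g_meas i x0) P0Fs.
pose h i (xi : borel_rV R m) := (1 - lam) * g i xs xi + lam * g i x0 xi.
pose F : set (borel_rV R m) := Xi `&` [set xi | (0 < max_pos (h^~ xi))%R].
have mh : measurable_fun Xi (fun xi => max_pos (h^~ xi)).
  apply: measurable_max_pos => i.
  by apply: measurable_funD; apply: measurable_funM => //; exact: g_meas.
have mF : measurable F by exact: mpos mh.
have lam01 : 0 <= lam <= 1 by rewrite !ltW.
have [t tE] := i01_of lam01.
pose xl := lam *: x0 + (1 - lam) *: xs.
have xlE : conv t (x0 : convex_lmodType 'rV[R]_n) xs = xl by rewrite /xl -tE.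
have Xxl : X xl.
  have := X_convex x0 xs t; rewrite !inE xlE; exact.
have g_xl i xi : Xi xi -> g i xl xi <= h i xi.
  move=> Xxi; have := g_convex i xi Xxi t x0 xs (in_setT _) (in_setT _).
  by rewrite xlE => /le_trans; apply; rewrite /h addrC -tE.
have wl_le : (worst_loss g Xi PP xs <= worst_loss g Xi PP xl)%E.
  by apply: xs_min; split => //; exact: le_dotp_convex.
have loss_ge0 (P : probability (borel_rV R m) R) (f : borel_rV R m -> 'I_k -> R) :
    (0 <= \int[P]_(xi in Xi) (max_pos (f xi))%:E)%E.
  by apply: integral_ge0 => xi _; rewrite lee_fin max_pos_ge0.
have loss_le P x : PP P ->
    (\int[P]_(xi in Xi) (max_pos (fun i => g i x xi))%:E <= worst_loss g Xi PP x)%E.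
  by move=> PPP; apply: ereal_sup_ubound; exists P.
(* Some minimizer at this level has finite worst-case loss, and [xs] does at least as well. *)
have [W WE] : exists W, worst_loss g Xi PP xs = W%:E.
  have [|x' [[Xx' cx'] _] x'fin] := lower_attained (dotp c x0); first by exists x0.
  exists (fine (worst_loss g Xi PP xs)); rewrite fineK// ge0_fin_numE.
    by rewrite (le_lt_trans (xs_min x' _))// -ge0_fin_numE// (le_trans _ (loss_le P0 x' P0ball)).
  by rewrite (le_trans _ (loss_le P0 xs P0ball)).
(* If W were 0, the loss of [xs], positive on [Fs], would have zero [P0]-integral there, so [Fs]
   would be [P0]-null. *)
have W0 : 0 < W.
  rewrite ltNge -lee_fin -WE; apply/negP => W0.
  have mFs : measurable Fs by exact: mpos (mg xs).
  suff P0Fs0 : P0 Fs = 0%E by move: P0Fs; rewrite P0Fs0 lte_fin; lra.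
  apply: (@integral_eq0_pos _ _ _ P0 (fun xi => (max_pos (fun i => g i xs xi))%:E)) => //.
  - by apply: (measurable_funS mXi (@subIsetl _ _ _)); exact/measurable_EFinP.
  - by move=> xi [_]; rewrite lte_fin.
  - apply/eqP; rewrite eq_le; apply/andP; split; last first.
      by apply: integral_ge0 => xi _; rewrite lee_fin max_pos_ge0.
    rewrite (le_trans _ W0)// (le_trans _ (loss_le P0 xs P0ball))//.
    apply: ge0_subset_integral => //.
    + exact/measurable_EFinP.
    + by move=> xi _; rewrite lee_fin max_pos_ge0.
    + exact: subIsetl.
(* The worst case at [xl] need not be attained; since W > 0, the slack between (1 - lam) * W and W
   yields an actual [P1]. *)
have [_ [P1 P1ball <-] P1gt] : exists2 y, [set (\int[P]_(xi in Xi)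
      (max_pos (fun i => g i xl xi))%:E)%E | P in PP] y & (((1 - lam) * W)%:E < y)%E.
  apply: ereal_sup_gt; apply: lt_le_trans wl_le.
  by rewrite WE lte_fin mulrBl mul1r ltrBlDr ltrDl mulr_gt0.
have [P [Pball PF P1P]] := Winfty_ball_merge normN mXi mF P0ball P1ball.
move: P1gt; apply/negP; rewrite -leNgt.
(* Convexity replaces the loss at [xl] by that of [h], which vanishes on [Xi] outside [F]; so [P1]
   may then be replaced by [P], for which the CVaR bound applies. *)
apply: (@le_trans _ _ (\int[P1]_(xi in Xi) (max_pos (h^~ xi))%:E)%E).
  apply: ge0_le_integral => //.
  - by move=> xi _; rewrite lee_fin max_pos_ge0.
  - exact/measurable_EFinP.
  - exact/measurable_EFinP.
  - move=> xi Xxi; rewrite lee_fin; apply: max_pos_le; first exact: max_pos_ge0.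
    by move=> i; rewrite (le_trans (g_xl i xi Xxi))// (le_max_pos (h^~ xi) i).
apply: (@le_trans _ _ (\int[P]_(xi in Xi) (max_pos (h^~ xi))%:E)%E).
  apply: (le_measure_integral_pos mXi mF) => //; first exact: subIsetl.
  - by move=> xi _; rewrite lee_fin max_pos_ge0.
  - exact/measurable_EFinP.
  - move=> xi Xxi nF; congr EFin; apply/eqP; rewrite eq_le max_pos_ge0 andbT leNgt.
    by apply/negP => hxi; apply: nF.
apply: (@integral_max_pos_convex_le _ (borel_rV R m) _ _ P _ mXi (g^~ xs) (g^~ x0) lam eps) => //.
- by rewrite lam0 lam1.
- exact: le_trans P0F PF.
- by apply: le_trans cvx0; apply: ereal_sup_ubound; exists P.
- by rewrite -WE; exact: loss_le.
Qed.
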